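(* Let (i) $p$ be a prime; (ii) $H$ be either $A_p$, $S_p$, or a subgroup of $\mathrm{AGL}(1,p)$ that contains $\mathbb{Z}_p$; (iii) $n$ be a natural number, such that either $n=2$, or $n\mid p-1$, or $n\mid m$, where $m$ satisfies $p=(r^{d^m}-1)/(r^d-1)$ for some prime $r$ and natural number $d$; (iv) $K$ be an $H$-invariant subgroup of $(\mathbb{Z}_n)^p$; and (v) $\phi\colon H\to(\mathbb{Z}_n)^p/K$ be a crossed homomorphism. Then $\phi$ is cohomologous to a homomorphism from $H$ to $C_0/(K\cap C_0)$, where $C_0$ is the repetition code in $(\mathbb{Z}_n)^p$.
   Context: $A_p$ and $S_p$ are the alternating and symmetric groups of degree $p$. $H\le S_p$ acts on $(\mathbb{Z}_n)^p$ by permuting coordinates (indexed by $\mathbb{Z}_p$), $(h\cdot v)_{h(i)}=v_i$. $\mathrm{AGL}(1,p)$ is the group of affine permutations of $\mathbb{F}_p$, and $\mathbb{Z}_p$ its translation subgroup. The repetition code is $C_0=\{(c,c,\dots,c):c\in\mathbb{Z}_n\}$, and $C_0/(K\cap C_0)$ is regarded as the subgroup $(C_0+K)/K$ of $(\mathbb{Z}_n)^p/K$ (on which $H$ acts trivially). For an $H$-module $A$ (an abelian group, written additively, on which $H$ acts by automorphisms), a function $\phi\colon H\to A$ is a crossed homomorphism if $\phi(h_1h_2)=h_2^{-1}\cdot\phi(h_1)+\phi(h_2)$ for all $h_1,h_2\in H$. Crossed homomorphisms $\phi_1,\phi_2\colon H\to A$ are cohomologous if there is $a\in A$ with $\phi_1(h)-\phi_2(h)=h^{-1}a-a$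 for every $h\in H$.
   Formalization: The case p = n = 2 is excluded, because the claim fails there: for H = S_2 and K = C_0, the nontrivial homomorphism from H to (Z_2)^2/K is a crossed homomorphism not cohomologous to the only homomorphism to C_0/(K∩C_0) = 0. *)

(* Defs.v *)
From HB Require Import structures.
From mathcomp Require Import all_boot all_order all_fingroup all_algebra.
From mathcomp Require Import all_solvable.

Set Implicit Arguments.
Unset Strict Implicit.
Unset Printing Implicit Defensive.

Import GRing.Theory.
Local Open Scope ring_scope.
Local Open Scope quotient_scope.

(* 'I_m.+1 carries the additive group Z/(m+1) for every m, whereas 'Z_1 would
   be Z/2.  Only meaningful for 0 < n. *)
Definition Zmod (n : nat) : finZmodType := 'I_n.-1.+1.

(* (Z_n)^p, with coordinates indexed by 'F_p (equal to Z_p for p prime). *)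
Definition code (p n : nat) : zmodType := {ffun 'F_p -> Zmod n}.

(* MathComp multiplies permutations left to right: (s * t) i = t (s i).
   Left actions on coordinates need the product h1 h2 = h1 \o h2. *)
Definition pcomp (T : finType) (h1 h2 : {perm T}) : {perm T} := (h2 * h1)%g.

(* Determined by (h . v)_(h i) = v_i; see coord_actE. *)
Definition coord_act (p n : nat) (h : {perm 'F_p}) (v : code p n) : code p n :=
  [ffun i => v (h^-1%g i)].

Lemma coord_actE p n (h : {perm 'F_p}) (v : code p n) i :
  coord_act h v (h i) = v i.
Proof. by rewrite ffunE permK. Qed.

Lemma coord_act1 p n (v : code p n) : coord_act 1%g v = v.
Proof. by apply/ffunP=> i; rewrite ffunE invg1 perm1. Qed.

Lemma coord_actM p n (h1 h2 : {perm 'F_p}) (v : code p n) :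
  coord_act (pcomp h1 h2) v = coord_act h1 (coord_act h2 v).
Proof. by apply/ffunP=> i; rewrite !ffunE invMg permM. Qed.

Lemma coord_actB p n (h : {perm 'F_p}) (u v : code p n) :
  coord_act h (u - v) = coord_act h u - coord_act h v.
Proof. by apply/ffunP=> i; rewrite !ffunE. Qed.

Definition invariant_code (p n : nat) (H : {set {perm 'F_p}})
    (K : zmodClosed (code p n)) : Prop :=
  forall h, h \in H -> forall v, v \in K -> coord_act h v \in K.

Definition qcode (p n : nat) (K : zmodClosed (code p n)) : zmodType :=
  Quotient.quot K.

Definition qclass (p n : nat) (K : zmodClosed (code p n)) (v : code p n) :
  qcode K := \pi_(Quotient.quot K) v.

(* Defined through representatives; well defined when K is invariant, see
   qcode_act_class. *)
Definition qcode_act (p n : nat) (K : zmodClosed (code p n)) (h : {perm 'F_p})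
    (x : qcode K) : qcode K :=
  qclass K (coord_act h (generic_quotient.repr (x : Quotient.quot K))).

Lemma qclass_eq p n (K : zmodClosed (code p n)) (u v : code p n) :
  (qclass K u == qclass K v) = (u - v \in K).
Proof. by rewrite Quotient.idealrBE. Qed.

Lemma qcode_act_class p n (H : {set {perm 'F_p}}) (K : zmodClosed (code p n)) :
  invariant_code H K ->
  forall h, h \in H -> forall v, qcode_act h (qclass K v) = qclass K (coord_act h v).
Proof.
move=> Kinv h hH v; apply/eqP; rewrite qclass_eq -coord_actB; apply: Kinv => //.
by rewrite -qclass_eq /qclass reprK.
Qed.

Section Cohomology.

Variables (T : finType) (A : zmodType) (act : {perm T} -> A -> A).
Variable H : {set {perm T}}.

(* Functions on H are total functions on {perm T} whose values off H are
   irrelevant. *)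
Definition crossed_hom (phi : {perm T} -> A) : Prop :=
  {in H &, forall h1 h2,
     phi (pcomp h1 h2) = act h2^-1%g (phi h1) + phi h2}.

Definition cohomologous (phi1 phi2 : {perm T} -> A) : Prop :=
  exists a : A, {in H, forall h, phi1 h - phi2 h = act h^-1%g a - a}.

Definition hom_into (B : A -> Prop) (psi : {perm T} -> A) : Prop :=
  {in H &, forall h1 h2, psi (pcomp h1 h2) = psi h1 + psi h2}
  /\ {in H, forall h, B (psi h)}.

End Cohomology.

Definition repetition_code (p n : nat) (v : code p n) : Prop :=
  exists c : Zmod n, v = [ffun=> c].

(* C_0 / (K :&: C_0), viewed as the subgroup (C_0 + K) / K of (Z_n)^p / K. *)
Definition qrepetition (p n : nat) (K : zmodClosed (code p n)) (x : qcode K) :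
  Prop := exists2 v : code p n, repetition_code v & x = qclass K v.

Definition AGL1 (p : nat) : {set {perm 'F_p}} :=
  [set s : {perm 'F_p} |
    [exists a : 'F_p, exists b : 'F_p,
      (a != 0) && [forall x : 'F_p, s x == a * x + b]]].

Definition translations (p : nat) : {set {perm 'F_p}} :=
  [set s : {perm 'F_p} | [exists b : 'F_p, [forall x : 'F_p, s x == x + b]]].

(* Main.v *)
(** Each admissible n divides p - 1: in the third case
  p = (q^(d^(m-1)) - 1)/(q - 1) with q = r^d forces m = 2, so n is 1 or 2.
  Hence multiplication by p is the identity on (Z_n)^p.  Averaging over the
  translations makes phi vanish on them, after subtracting a coboundary.  A
  value phi(h) is then translation-invariant, i.e. a class of C_0, as soon as
  phi vanishes on the conjugates by h of translations.  This settles AGL(1,p);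
  for A_p and S_p with p >= 5 it reduces to A_p, since on A_p phi is then a
  homomorphism to a group of exponent prime to p.  For A_p, K contains
  x(e_k - e_l) for every difference x of two coordinates of a codeword of K,
  so the deviation of the i-th coordinate from the mean is a well-defined
  invariant of classes.  Applied to phi, it is a homomorphism on the
  stabiliser of i in A_p, which vanishes on 3-cycles and so everywhere; then
  phi(h) has constant coordinates modulo K. *)

Require Import Defs.
From HB Require Import structures.
From mathcomp Require Import all_boot all_order all_fingroup all_algebra.
From mathcomp Require Import all_solvable.

Set Implicit Arguments.
Unset Strict Implicit.
Unset Printing Implicit Defensive.

Import GRing.Theory.

(** * 3-cycles and even permutations fixing a point *)

Section ThreeCycles.

Variable T : finType.
Implicit Types (a b c x : T) (s : {perm T}).

Definition cycle3 a b c : {perm T} := (tperm a b * tperm a c)%g.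

Lemma cycle3_even a b c : a != b -> a != c -> cycle3 a b c = false :> bool.
Proof. by move=> ab ac; rewrite odd_permM !odd_tperm ab ac. Qed.

Lemma cycle3L a b c : a != b -> b != c -> cycle3 a b c a = b.
Proof. by move=> ab bc; rewrite permM tpermL tpermD // eq_sym. Qed.

Lemma cycle3M a b c : cycle3 a b c b = c.
Proof. by rewrite permM tpermR tpermL. Qed.

Lemma cycle3R a b c : a != c -> b != c -> cycle3 a b c c = a.
Proof. by move=> ac bc; rewrite permM [tperm a b c]tpermD // tpermR. Qed.

Lemma cycle3D a b c x : x != a -> x != b -> x != c -> cycle3 a b c x = x.
Proof.
by move=> xa xb xc; rewrite permM [tperm a b x]tpermD 1?eq_sym // tpermD // eq_sym.
Qed.

Lemma cycle3V a b c : ((cycle3 a b c)^-1 = cycle3 a c b)%g.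
Proof. by rewrite invMg !tpermV. Qed.

Lemma cycle3_cube a b c :
  a != b -> a != c -> b != c -> (cycle3 a b c * cycle3 a b c * cycle3 a b c = 1)%g.
Proof.
move=> ab ac bc; apply/permP=> x; rewrite perm1 2!permM.
have [->|xa] := eqVneq x a; first by rewrite cycle3L // cycle3M cycle3R.
have [->|xb] := eqVneq x b; first by rewrite cycle3M cycle3R // cycle3L.
have [->|xc] := eqVneq x c; first by rewrite cycle3R // cycle3L // cycle3M.
by rewrite !cycle3D.
Qed.

(* A double transposition (a b)(d e) inverts the cycle (a b c). *)
Lemma cycle3_sandwich a b c d e : uniq [:: a; b; c; d; e] ->
  (cycle3 a b c * (tperm a b * tperm d e) * cycle3 a b c
   = tperm a b * tperm d e)%g.
Proof.
rewrite /= !inE !negb_or -!andbA => /and5P[ab ac ad ae /and5P[bc bd be cd]].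
move=> /and3P[ce de _].
have comm_de : (tperm d e * cycle3 a b c = cycle3 a b c * tperm d e)%g.
  by rewrite conjgC tpermJ !cycle3D // eq_sym.
rewrite -!mulgA comm_de !mulgA; congr (_ * _)%g.
by rewrite /cycle3 -!mulgA tpermKg tperm2 mulg1.
Qed.

(** Even permutations fixing [x0] are peeled into 3-cycles: with [b = s a], the product
    [cycle3 b a c * s] fixes [b] and moves no new point, so induction on the size of the support
    applies. *)
Lemma even_stab_ind (x0 : T) (P : {perm T} -> Prop) :
    P 1%g ->
    (forall a b c s, uniq [:: x0; a; b; c] -> s x0 = x0 -> s = false :> bool ->
       P s -> P (cycle3 a b c * s)%g) ->
  forall s, s x0 = x0 -> s = false :> bool -> P s.
Proof.
move=> P1 PM s; move: {2}_.+1 (ltnSn #|[set x | s x != x]|) => m.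
elim: m s => // m IHm s le_m sx0 s_even.
have [->//|/eqP s1] := eqVneq s 1%g.
have [a sa] : exists a, s a != a.
  apply/existsP; apply: contraPT s1; rewrite negb_exists => /forallP fix_s.
  by case; apply/permP=> x; rewrite perm1; apply/eqP; rewrite -[_ == _]negbK.
set b := s a in sa.
have sb : s b != b by rewrite (inj_eq perm_inj).
(* Without a third moved point, [s] would be the transposition of [a] and [b], which is odd. *)
have [c /and3P[sc ca cb]] : exists c, [&& s c != c, c != a & c != b].
  apply/existsP; apply: contraFT s_even; rewrite negb_exists => /forallP fix_s.
  suff -> : s = tperm a b by rewrite odd_tperm eq_sym.
  have fixs x : x != a -> x != b -> s x = x.
    by move=> xa xb; apply/eqP; move: (fix_s x); rewrite xa xb !andbT negbK.
  apply/permP=> x; case: tpermP => [-> //|->|/eqP xa /eqP xb]; last exact: fixs.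
  apply/eqP; apply: contraT => sba.
  by have := fixs _ sba sb => /perm_inj/eqP; rewrite (negPf sb).
have x0D x : s x != x -> x0 != x.
  by apply: contraNneq => <-; rewrite sx0.
have r_even : cycle3 b a c = false :> bool by rewrite cycle3_even // eq_sym.
have rs : s = (cycle3 b c a * (cycle3 b a c * s))%g.
  by rewrite -[cycle3 b c a]cycle3V mulKg.
rewrite rs; apply: PM.
- by rewrite /= !inE !negb_or !x0D // [b == c]eq_sym cb sa ca.
- by rewrite permM cycle3D ?x0D.
- by rewrite odd_permM r_even s_even.
apply: IHm; last by rewrite odd_permM r_even s_even.
  rewrite ltnS in le_m; apply: leq_trans le_m; apply: proper_card.
  apply/properP; split; last first.
    by exists b; rewrite !inE ?sb // negbK permM cycle3L -/b ?eqxx // eq_sym.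
  apply/subsetP=> x; rewrite !inE; apply: contraNN => /eqP sx.
  have xD y : s y != y -> x != y by apply: contraNneq => <-; apply/eqP.
  by rewrite permM cycle3D ?xD // sx.
by rewrite permM cycle3D ?x0D.
Qed.

End ThreeCycles.
Lemma notin_seq_ex (T : finType) (s : seq T) :
  size s < #|T| -> exists x, x \notin s.
Proof.
move=> lt_s; apply/existsP; apply: contraLR lt_s; rewrite negb_exists -leqNgt.
move=> /forallP s_all; apply: leq_trans (card_size s); apply: subset_leq_card.
by apply/subsetP=> x _; rewrite -[x \in s]negbK.
Qed.

(** * Vanishing of cocycles on the alternating group *)

Section AltCocycle.

Local Open Scope ring_scope.
Variables (T : finType) (A : zmodType) (w : {perm T} -> T -> A).
Hypothesis T_ge5 : (5 <= #|T|)%N.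
Hypothesis A_cardT : forall z : A, z *+ #|T| = z.
Hypothesis wM : forall (x y : {perm T}) i,
  x = false :> bool -> y = false :> bool -> w (x * y)%g i = w y (x i) + w x i.

Lemma alt_cocycle1 i : w 1%g i = 0.
Proof.
apply: (addrI (w 1%g i)); rewrite addr0.
by have := wM i (odd_perm1 T) (odd_perm1 T); rewrite mulg1 perm1.
Qed.

(** On even permutations fixing [i], [w _ i] is additive, so a 3-cycle has a value [z] with
    [3z = 0]. For degree 5, [5z = z] finishes; for larger degree there is room for a double
    transposition inverting the cycle, whence [2z = 0]. *)
Lemma alt_cocycle_cycle3 i a b c :
  uniq [:: i; a; b; c] -> w (cycle3 a b c) i = 0.
Proof.
move=> iabc; have := iabc; rewrite /= !inE !negb_or -!andbA.
move=> /and5P[ia ib ic ab /and3P[ac bc _]].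
have c_even : cycle3 a b c = false :> bool by rewrite cycle3_even.
have ci : cycle3 a b c i = i by rewrite cycle3D.
have c_cube := cycle3_cube ab ac bc.
have c_sandwich d e := @cycle3_sandwich _ a b c d e.
move: (cycle3 a b c) c_even ci c_cube c_sandwich => r r_even ri r_cube r_sandwich.
set z := w r i.
have z3 : z *+ 3 = 0.
  rewrite -(alt_cocycle1 i) -r_cube !wM ?odd_permM ?r_even // permM !ri.
  by rewrite mulrS mulr2n.
have [T5|T6] := leqP #|T| 5.
  have := A_cardT z; have -> : #|T| = (3 + 2)%N by apply/eqP; rewrite eqn_leq T5.
  rewrite mulrnDr z3 add0r => z2.
  by apply: (addrI z); rewrite addr0 -mulr2n.
have [d d_new] := @notin_seq_ex T [:: i; a; b; c] T_ge5.
have [e e_new] := @notin_seq_ex T [:: i; a; b; c; d] T6.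
move: d_new e_new; rewrite !inE !negb_or.
move=> /and4P[di da db dc] /and5P[ei ea eb ec ed].
have abcde : uniq [:: a; b; c; d; e].
  by rewrite /= !inE !negb_or ab ac bc /= !(eq_sym _ d) !(eq_sym _ e) da db dc
    ea eb ec ed.
have v_even : (tperm a b * tperm d e)%g = false :> bool.
  by rewrite odd_permM !odd_tperm ab eq_sym ed.
have vi : (tperm a b * tperm d e)%g i = i.
  by rewrite permM !tpermD // eq_sym.
have := congr1 (fun s => w s i) (r_sandwich d e abcde).
move: (_ * _)%g v_even vi => v v_even vi.
rewrite !wM ?odd_permM ?r_even ?v_even // permM ri vi -/z.
rewrite addrCA -[RHS]addr0 => /addrI z2.
by move: z3; rewrite mulrS mulr2n z2 addr0.
Qed.

Lemma alt_cocycle_stab i (s : {perm T}) :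
  s i = i -> s = false :> bool -> w s i = 0.
Proof.
move=> si s_even; have [] // : s = false :> bool /\ w s i = 0.
move: s si s_even; apply: even_stab_ind.
  by rewrite odd_perm1 alt_cocycle1.
move=> a b c s iabc si _ [s_even ws0]; have := iabc.
rewrite /= !inE !negb_or -!andbA => /and5P[ia ib ic ab /and3P[ac bc _]].
have c_even : cycle3 a b c = false :> bool by rewrite cycle3_even.
by rewrite odd_permM c_even s_even wM // cycle3D // ws0 add0r alt_cocycle_cycle3.
Qed.

(** Multiplying [s] by an even [t] that sends [s i] back to [i] and has zero cocycle keeps the value
    at [i] and lands in the stabiliser of [i]. *)
Lemma alt_cocycle0 :
    (forall i j, exists t : {perm T},
      [/\ t = false :> bool, t i = j & forall k, w t k = 0]) ->
  forall (s : {perm T}) i, s = false :> bool -> w s i = 0.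
Proof.
move=> w_trans s i s_even; have [t [t_even tsi wt0]] := w_trans (s i) i.
have <- : w (s * t)%g i = w s i by rewrite wM // wt0 add0r.
by apply: alt_cocycle_stab; rewrite ?permM // odd_permM s_even t_even.
Qed.

End AltCocycle.

(** * The translation subgroup *)

Section Translations.

Local Open Scope ring_scope.
Variable p : nat.
Hypothesis p_prime : prime p.

Definition transl (b : 'F_p) : {perm 'F_p} := perm (addIr b).

Lemma translE b x : transl b x = x + b.
Proof. by rewrite permE. Qed.

Lemma translM b c : (transl b * transl c)%g = transl (b + c).
Proof. by apply/permP=> x; rewrite permM !translE addrA. Qed.

Lemma transl0 : transl 0 = 1%g.
Proof. by apply/permP=> x; rewrite translE addr0 perm1. Qed.

Lemma translX b k : (transl b ^+ k)%g = transl (b *+ k).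
Proof.
by elim: k => [|k IHk]; rewrite ?mulr0n ?transl0 // expgS IHk translM mulrS.
Qed.

Lemma Fp_mulrn_p (b : 'F_p) : b *+ p = 0.
Proof. by rewrite -mulr_natr pchar_Fp_0 ?mulr0. Qed.

Lemma transl_order b : (transl b ^+ p)%g = 1%g.
Proof. by rewrite translX Fp_mulrn_p transl0. Qed.

Lemma mem_transl b : transl b \in translations p.
Proof.
by rewrite inE; apply/existsP; exists b; apply/forallP=> x; rewrite translE.
Qed.

Lemma translationsP t : reflect (exists b, t = transl b) (t \in translations p).
Proof.
apply: (iffP idP) => [|[b ->]]; last exact: mem_transl.
rewrite inE => /existsP[b /forallP tE]; exists b; apply/permP=> x.
by rewrite translE; apply/eqP.
Qed.

(** For odd [p], [(p + 1)/2] is the inverse of 2 modulo [p], so each translation is the square of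
    another. *)
Lemma transl_even b : odd p -> transl b = false :> bool.
Proof.
move=> p_odd; have -> : b = b *+ p.+1./2 + b *+ p.+1./2.
  rewrite -mulrnDr addnn; have := odd_double_half p.+1.
  by rewrite /= p_odd /= add0n => ->; rewrite mulrSr Fp_mulrn_p add0r.
by rewrite -translM odd_permM addbb.
Qed.

Lemma translations_sub_Alt : odd p -> translations p \subset ('Alt_('F_p))%g.
Proof.
by move=> p_odd; apply/subsetP=> _ /translationsP[b ->]; rewrite Alt_even transl_even.
Qed.

(** Both groups have order 3. This disposes of degree 3, where the arguments with spare points
    fail. *)
Lemma Alt3_translations : p = 3 -> ('Alt_('F_p))%g = translations p.
Proof.
move=> p3; have p_odd : odd p by rewrite p3.
apply/esym/eqP; rewrite eqEcard translations_sub_Alt //=.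
have -> : translations p = [set transl b | b in 'F_p].
  apply/setP=> t; apply/translationsP/imsetP => [[b ->]|[b _ ->]]; by exists b.
rewrite card_imset ?card_Fp // => [|b c /permP/(_ 0)]; last by rewrite !translE !add0r.
by rewrite -(leq_pmul2l (ltn0Sn 1)) card_Alt card_Fp ?p3.
Qed.

Lemma AGL1_normalises_translations h t :
  h \in AGL1 p -> t \in translations p -> (t ^ h)%g \in translations p.
Proof.
rewrite inE => /existsP[a /existsP[b /andP[a0 /forallP hE]]] /translationsP[c ->].
have {}hE x : h x = a * x + b by apply/eqP.
apply/translationsP; exists (a * c); apply/permP=> x.
by rewrite -[x](permKV h) conjgE !permM permK !translE !hE mulrDr addrAC.
Qed.

End Translations.

HB.instance Definition _ p n (K : zmodClosed (code p n)) :=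
  GRing.isZmodMorphism.Build (code p n) (qcode K) (qclass K)
    (@pi_is_zmod_morphism _ _ _ (Quotient.quot K)).

(** * Crossed homomorphisms into the quotient code *)

Section CrossedHoms.

Local Open Scope ring_scope.
Variables (p n : nat) (H : {group {perm 'F_p}}) (K : zmodClosed (code p n)).
Hypothesis p_prime : prime p.
Hypothesis Zmod_mulrn_p : forall x : Zmod n, x *+ p = x.
Hypothesis K_inv : invariant_code H K.

Local Notation act := (@qcode_act p n K).
Local Notation qrep := (@qrepetition p n K).

Lemma qclassP (x : qcode K) : exists v, x = qclass K v.
Proof. by exists (generic_quotient.repr (x : Quotient.quot K)); rewrite /qclass reprK. Qed.

Lemma qclass_eq0 (v : code p n) : (qclass K v == 0) = (v \in K).
Proof. by rewrite -(raddf0 (qclass K)) qclass_eq subr0. Qed.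

Lemma code_mulrn_p (v : code p n) : v *+ p = v.
Proof. by apply/ffunP=> i; rewrite ffunMnE Zmod_mulrn_p. Qed.

Lemma qcode_mulrn_p (x : qcode K) : x *+ p = x.
Proof. by have [v ->] := qclassP x; rewrite -raddfMn code_mulrn_p. Qed.

Lemma qcode_actB h x y : h \in H -> act h (x - y) = act h x - act h y.
Proof.
move=> hH; have [u ->] := qclassP x; have [v ->] := qclassP y.
by rewrite -raddfB !(qcode_act_class K_inv hH) coord_actB raddfB.
Qed.

Lemma qcode_act0 h : h \in H -> act h 0 = 0.
Proof. by move=> hH; rewrite -{1}(subrr 0) qcode_actB // subrr. Qed.

Lemma qcode_actN h x : h \in H -> act h (- x) = - act h x.
Proof. by move=> hH; rewrite -sub0r qcode_actB // qcode_act0 // sub0r. Qed.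

Lemma qcode_actD h x y : h \in H -> act h (x + y) = act h x + act h y.
Proof. by move=> hH; rewrite -{1}[y]opprK qcode_actB // qcode_actN // opprK. Qed.

Lemma qcode_act_sum h (I : finType) (F : I -> qcode K) :
  h \in H -> act h (\sum_i F i) = \sum_i act h (F i).
Proof.
move=> hH; apply: (big_morph (act h)) => [x y|]; first exact: qcode_actD.
exact: qcode_act0.
Qed.

Lemma qcode_act1 x : act 1%g x = x.
Proof.
by have [v ->] := qclassP x; rewrite (qcode_act_class K_inv (group1 H)) coord_act1.
Qed.

Lemma qcode_actM g h x : g \in H -> h \in H -> act (g * h)%g x = act h (act g x).
Proof.
move=> gH hH; have [v ->] := qclassP x.
by rewrite !(qcode_act_class K_inv) ?groupM // -coord_actM.
Qed.

(** As [p] acts as 1 on [Zmod n], this sum is also the mean of the coordinates. *)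
Definition weight (v : code p n) : Zmod n := \sum_i v i.

Lemma qrepetition_act h x : h \in H -> qrep x -> act h x = x.
Proof.
move=> hH [v [c ->] ->]; rewrite (qcode_act_class K_inv) //; congr qclass.
by apply/ffunP=> i; rewrite !ffunE.
Qed.

Lemma qrepetition0 : qrep 0.
Proof.
by exists 0; [exists 0; apply/ffunP=> i; rewrite !ffunE | rewrite raddf0].
Qed.

Lemma qrepetitionMn x k : qrep x -> qrep (x *+ k).
Proof.
move=> [v [c ->] ->]; exists ([ffun=> c] *+ k); last by rewrite raddfMn.
by exists (c *+ k); apply/ffunP=> i; rewrite ffunMnE !ffunE.
Qed.

Hypothesis transl_sub : translations p \subset H.

Lemma transl_in b : transl b \in H.
Proof. exact: subsetP transl_sub _ (mem_transl b). Qed.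

(* Since n divides p - 1, x is the sum of its p translates. *)
Lemma transl_fixed_qrepetition x :
  (forall b, act (transl b) x = x) -> qrep x.
Proof.
have [v ->] := qclassP x => vT; exists [ffun=> weight v]; first by exists (weight v).
rewrite -[LHS]qcode_mulrn_p.
have -> : qclass K v *+ p = \sum_(b : 'F_p) act (transl (- b)) (qclass K v).
  by under eq_bigr do rewrite vT; rewrite sumr_const card_Fp.
under eq_bigr => b _ do rewrite (qcode_act_class K_inv (transl_in _)).
rewrite -raddf_sum; congr qclass; apply/ffunP=> i; rewrite sum_ffunE ffunE.
rewrite /weight [RHS](reindex_inj (addrI i)); apply: eq_bigr => b _.
by rewrite ffunE; congr (v _); apply/(canLR (permK _)); rewrite translE addrK.
Qed.

Section OneCrossedHom.

Variable phi : {perm 'F_p} -> qcode K.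
Hypothesis phi_crossed : crossed_hom act H phi.

(** The product [x * y] is [pcomp y x], so the two factors trade places in the cocycle law. *)
Lemma crossed_homM x y : x \in H -> y \in H ->
  phi (x * y)%g = act x^-1%g (phi y) + phi x.
Proof. by move=> xH yH; apply: phi_crossed. Qed.

Lemma crossed_hom1 : phi 1%g = 0.
Proof.
apply: (addrI (phi 1%g)); rewrite addr0.
by have := crossed_homM (group1 H) (group1 H); rewrite mulg1 invg1 qcode_act1.
Qed.

Lemma crossed_homX x k : x \in H -> qrep (phi x) -> phi (x ^+ k)%g = phi x *+ k.
Proof.
move=> xH qx; elim: k => [|k IHk]; first by rewrite crossed_hom1.
rewrite expgS crossed_homM ?groupX // IHk qrepetition_act ?groupV //.
  by rewrite mulrSr.
exact: qrepetitionMn.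
Qed.

(** Summing the cocycle law over all translations [c] composed with [b] yields [p] copies of
    [phi (transl b)], which equal a single one; the negated sum of values is the witness. *)
Lemma crossed_hom_coboundary_translations :
  exists a, forall b, phi (transl b) = act (transl b)^-1%g a - a.
Proof.
pose s := \sum_b phi (transl b); exists (- s) => b.
have sE : s = act (transl b)^-1%g s + phi (transl b).
  rewrite {1}/s (reindex_inj (addrI b)).
  under eq_bigr => c _ do rewrite -translM (crossed_homM (transl_in _) (transl_in _)).
  by rewrite big_split sumr_const card_Fp // qcode_mulrn_p /= -qcode_act_sum ?groupV ?transl_in.
by rewrite qcode_actN ?groupV ?transl_in // opprK {2}sE addKr.
Qed.

Lemma crossed_homB_coboundary a :
  crossed_hom act H (fun h => phi h - (act h^-1%g a - a)).
Proof.
move=> x y xH yH; rewrite /pcomp crossed_homM //.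
rewrite invMg qcode_actM ?groupV // !qcode_actB ?groupV //.
by rewrite [RHS]addrACA -opprD subrKA.
Qed.

Hypothesis phi_transl : forall b, phi (transl b) = 0.

(** For a translation [t], expanding [phi] on both sides of [t * h = h * t ^ h] shows that [t^-1]
    fixes [phi h]. *)
Lemma crossed_hom_transl_conj :
    (forall h b, h \in H -> phi (transl b ^ h)%g = 0) ->
  forall h, h \in H -> qrep (phi h).
Proof.
move=> phi_conj h hH; apply: transl_fixed_qrepetition => b.
have -> : transl b = (transl (- b))^-1%g.
  by apply/esym/eqP; rewrite eq_invg_mul translM addNr transl0.
rewrite -[LHS]addr0 -(phi_transl (- b)) -crossed_homM ?transl_in // conjgC.
by rewrite crossed_homM ?groupJ ?transl_in // phi_conj // qcode_act0 ?groupV // add0r.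
Qed.

End OneCrossedHom.
End CrossedHoms.

(** * Codes invariant under the alternating group *)

Section AltInvariantCodes.

Local Open Scope ring_scope.
Variables (p n : nat) (K : zmodClosed (code p n)).
Hypothesis p_prime : prime p.
Hypothesis p_ge5 : (5 <= p)%N.
Hypothesis Zmod_mulrn_p : forall x : Zmod n, x *+ p = x.
Hypothesis K_alt : invariant_code ('Alt_('F_p))%g K.

Lemma Fp_notin_seq_ex (s : seq 'F_p) : (size s < 5)%N -> exists x, x \notin s.
Proof.
by move=> lt_s; apply: notin_seq_ex; rewrite card_Fp //; apply: leq_trans p_ge5.
Qed.

Lemma cycle3_invariant a b c v :
  a != b -> a != c -> v \in K -> coord_act (cycle3 a b c) v \in K.
Proof. by move=> ab ac; apply: K_alt; rewrite Alt_even cycle3_even. Qed.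

(** The vector [x(e_k - e_l)]; the Booleans serve as multiplicities, so that [k = l] gives 0. *)
Definition root_vec (k l : 'F_p) (x : Zmod n) : code p n :=
  [ffun i => x *+ (i == k) - x *+ (i == l)].

Lemma root_vecB k l : {morph root_vec k l : x y / x - y}.
Proof.
move=> x y; apply/ffunP=> i; rewrite !ffunE !mulrnBl !opprB.
by rewrite addrACA [RHS]addrACA; congr (_ + _); apply: addrC.
Qed.

HB.instance Definition _ k l :=
  GRing.isZmodMorphism.Build (Zmod n) (code p n) (root_vec k l) (root_vecB k l).

Lemma coord_act_root_vec h k l x :
  coord_act h (root_vec k l x) = root_vec (h k) (h l) x.
Proof. by apply/ffunP=> i; rewrite !ffunE !(canF_eq (permKV h)) . Qed.

Lemma root_vec_refl k x : root_vec k k x = 0.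
Proof. by apply/ffunP=> i; rewrite !ffunE subrr. Qed.

Lemma root_vec_sub k l m x : root_vec k m x - root_vec l m x = root_vec k l x.
Proof. by apply/ffunP=> i; rewrite !ffunE opprB addrA subrK. Qed.

(** A 3-cycle [(k i m)] avoiding [l] carries [e_k - e_l] to [e_i - e_l]; the auxiliary point [m]
    makes the move even. Differences then give all pairs. *)
Lemma root_vec_spread k l x : k != l -> root_vec k l x \in K ->
  forall i j, root_vec i j x \in K.
Proof.
move=> kl klK; have main i : root_vec i l x \in K.
  have [->|ik] := eqVneq i k; first by [].
  have [->|il] := eqVneq i l; first by rewrite root_vec_refl rpred0.
  have [m] := @Fp_notin_seq_ex [:: k; l; i] isT.
  rewrite !inE !negb_or => /and3P[mk ml mi].
  have := @cycle3_invariant k i m (root_vec k l x).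
  rewrite coord_act_root_vec cycle3L 1?cycle3D // 1?eq_sym //.
  by apply=> //; rewrite eq_sym.
by move=> i j; rewrite -(root_vec_sub i j l) rpredB.
Qed.

(* If s is the cycle (j i m), w = v - s v is supported on {i, j, m} with
   w_i = v_i - v_j; a cycle (i a b) meeting this support only in i then
   isolates w_i. *)
Lemma root_vec_difference v i j : v \in K ->
  forall k l, root_vec k l (v i - v j) \in K.
Proof.
move=> vK; have [->|ij] := eqVneq i j.
  by move=> k l; rewrite subrr raddf0 rpred0.
have [m] := @Fp_notin_seq_ex [:: i; j] isT.
rewrite !inE !negb_or => /andP[mi mj].
have [a] := @Fp_notin_seq_ex [:: i; j; m] isT.
rewrite !inE !negb_or => /and3P[ai aj am].
have [b] := @Fp_notin_seq_ex [:: i; j; m; a] isT.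
rewrite !inE !negb_or => /and4P[bi bj bm ba].
have [ia ib ab] : [/\ i != a, i != b & a != b] by rewrite (eq_sym i a) (eq_sym i b) (eq_sym a b).
apply: (@root_vec_spread i a) => //; pose w := v - coord_act (cycle3 j i m) v.
have wE x : w x = v x - v (cycle3 j m i x) by rewrite !ffunE cycle3V.
have w0 x : x != i -> x != j -> x != m -> w x = 0.
  by move=> xi xj xm; rewrite wE cycle3D // subrr.
have wi : w i = v i - v j by rewrite wE cycle3R // eq_sym.
have wK : w \in K by rewrite rpredB // cycle3_invariant // eq_sym.
suff -> : root_vec i a (v i - v j) = w - coord_act (cycle3 i a b) w.
  by rewrite rpredB // cycle3_invariant // eq_sym.
have subE (u u' : code p n) x : (u - u') x = u x - u' x by rewrite !ffunE.
have actE x : coord_act (cycle3 i a b) w x = w (cycle3 i b a x).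
  by rewrite ffunE cycle3V.
apply/ffunP=> x; rewrite subE actE ffunE -wi.
have [->|xi] := eqVneq x i.
  by rewrite cycle3L ?(w0 b) ?(negPf ia) // eq_sym.
have [->|xa] := eqVneq x a.
  by rewrite cycle3R ?(w0 a) // eq_sym.
have [->|xb] := eqVneq x b; first by rewrite cycle3M (w0 b) // (w0 a).
by rewrite cycle3D // !mulr0n !subrr.
Qed.

(** The pair 0, 1 is one fixed choice of distinct positions: by [root_vec_spread], whether the root
    vector lies in [K] does not depend on the pair. *)
Definition dev_class (i : 'F_p) (v : code p n) : qcode K :=
  qclass K (root_vec 0 1 (v i - weight v)).

Lemma dev_classB i : {morph dev_class i : u v / u - v}.
Proof.
move=> u v; rewrite /dev_class -!raddfB; congr (qclass K (root_vec _ _ _)).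
rewrite /weight !ffunE; under eq_bigr do rewrite !ffunE.
by rewrite sumrB !opprB addrACA [RHS]addrACA; congr (_ + _); apply: addrC.
Qed.

HB.instance Definition _ i :=
  GRing.isZmodMorphism.Build (code p n) (qcode K) (dev_class i) (dev_classB i).

Lemma dev_class_act h i v : dev_class i (coord_act h^-1%g v) = dev_class (h i) v.
Proof.
rewrite /dev_class ffunE invgK; congr (qclass K (root_vec _ _ (_ - _))).
rewrite /weight [RHS](reindex_inj (@perm_inj _ h)); apply: eq_bigr => j _.
by rewrite ffunE invgK.
Qed.

Lemma dev_class_eq0 i v : v \in K -> dev_class i v = 0.
Proof.
(* Writing [v i] as [p] copies of itself turns the deviation into the sum over [j] of
   [v i - v j]. *)
move=> vK; apply/eqP; rewrite qclass_eq0 -[v i]Zmod_mulrn_p.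
rewrite -[X in _ *+ X](card_Fp p_prime) -sumr_const /weight -sumrB raddf_sum.
by apply: rpred_sum => j _; apply: root_vec_difference.
Qed.

Lemma dev_class_qrepetition v :
  (forall i, dev_class i v = 0) -> qrepetition (qclass K v).
Proof.
move=> dev0; exists [ffun=> weight v]; first by exists (weight v).
have d0 i : root_vec i 0 (v i - weight v) \in K.
  apply: (@root_vec_spread 0 1); first by rewrite eq_sym oner_eq0.
  by rewrite -qclass_eq0; apply/eqP/dev0.
apply/eqP; rewrite qclass_eq.
(* The [e_0] terms cancel because the deviations sum to [weight v - p * weight v = 0]. *)
suff -> : v - [ffun=> weight v] = \sum_i root_vec i 0 (v i - weight v).
  by apply: rpred_sum => i _; apply: d0.
apply/ffunP=> x; rewrite sum_ffunE.
under [RHS]eq_bigr do rewrite ffunE.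
rewrite sumrB sumrMnl sumrB sumr_const card_Fp // Zmod_mulrn_p subrr mul0rn subr0.
rewrite (bigD1 x) //= eqxx big1 => [|i /negPf]; first by rewrite addr0 !ffunE.
by rewrite eq_sym => ->.
Qed.

Lemma alt_crossed_hom_qrepetition phi :
    crossed_hom (@qcode_act p n K) ('Alt_('F_p))%g phi ->
    (forall b, phi (transl b) = 0) ->
  forall h, h \in ('Alt_('F_p))%g -> qrepetition (phi h).
Proof.
move=> phi_crossed phi_transl h; rewrite Alt_even => /negbTE h_even.
pose rep h := generic_quotient.repr (phi h : Quotient.quot K).
have repK g : qclass K (rep g) = phi g by rewrite /qclass reprK.
have p_odd : odd p by apply: contraLR p_ge5; case/even_prime: p_prime => ->.
rewrite -repK; apply: dev_class_qrepetition => i.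
apply: (@alt_cocycle0 _ _ (fun g i => dev_class i (rep g))) => //.
- by rewrite card_Fp.
- by move=> z; rewrite card_Fp // qcode_mulrn_p.
(* Representatives satisfy the cocycle law only modulo [K], and [dev_class] vanishes on [K]. *)
- move=> x y k x_even y_even; rewrite -dev_class_act -raddfD; apply/eqP.
  rewrite -subr_eq0 -raddfB; apply/eqP/dev_class_eq0; rewrite -qclass_eq.
  have [xA yA] : x \in ('Alt_('F_p))%g /\ y \in ('Alt_('F_p))%g.
    by rewrite !Alt_even x_even y_even.
  rewrite raddfD /= -(qcode_act_class K_alt) ?groupV // !repK.
  by rewrite (crossed_homM phi_crossed).
move=> k l; exists (transl (l - k)).
rewrite transl_even // translE addrC subrK; split=> // m.
by apply: dev_class_eq0; rewrite -qclass_eq0 repK phi_transl.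
Qed.

End AltInvariantCodes.

(** * Arithmetic of the admissible moduli *)

Lemma prime_repunit_exponent p m r d :
  prime p -> prime r -> 0 < d -> p * (r ^ d - 1) = r ^ (d ^ m) - 1 -> m = 2.
Proof.
move=> p_prime r_prime d_gt0 pE.
have r_gt1 := prime_gt1 r_prime; have p_gt1 := prime_gt1 p_prime.
have r_gt0 := ltnW r_gt1.
have q_gt1 : 1 < r ^ d by rewrite -(expn0 r) ltn_exp2l.
have [d1|d1] := eqVneq d 1.
  move: pE; rewrite d1 exp1n expn1 => /eqP.
  by rewrite -[X in _ == X]mul1n eqn_pmul2r ?subn_gt0 // => /eqP p1; rewrite p1 in p_gt1.
have d_gt1 : 1 < d by rewrite ltn_neqAle eq_sym d1.
(* Exponents 0 and 1 would force [p <= 1]. In the last case [m] stands for the original exponent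
   minus 3. *)
case: m pE => [|[|[//|m]]] pE.
- have : p * (r ^ d - 1) <= r ^ d - 1 by rewrite pE expn0 leq_sub2r ?leq_exp2l.
  by rewrite -[X in _ <= X]mul1n leq_pmul2r ?subn_gt0 // leqNgt p_gt1.
- move: pE; rewrite expn1 => /eqP.
  by rewrite -[X in _ == X]mul1n eqn_pmul2r ?subn_gt0 // => /eqP p1; rewrite p1 in p_gt1.
(* With q = r ^ d, p = (q ^ (d * b) - 1) / (q - 1) has the proper factor
   (q ^ d - 1) / (q - 1). *)
pose b := d ^ m.+1.
have b_gt1 : 1 < b by rewrite -(expn0 d) ltn_exp2l.
have dvd_pred x k : x - 1 %| x ^ k - 1.
  by rewrite -{2}(exp1n k) subn_exp dvdn_mulr.
have {}pE : p * (r ^ d - 1) = (r ^ d) ^ (d * b) - 1.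
  by rewrite pE -expnM -!expnS.
set q := r ^ d in q_gt1 pE.
have q1_gt0 : 0 < q - 1 by rewrite subn_gt0.
have qd_gt : q < q ^ d by rewrite -{1}(expn1 q) ltn_exp2l.
have qdb_gt : q ^ d < q ^ (d * b) by rewrite ltn_exp2l // ltn_Pmulr // ltnW.
have [s sE] := dvdnP (dvd_pred q d).
have [t tE] := dvdnP (dvd_pred (q ^ d) b).
have pred_lt x y : 0 < x -> x < y -> x - 1 < y - 1.
  by move=> x_gt0 xy; rewrite ltn_sub2r // (leq_ltn_trans x_gt0).
have s1 : s != 1.
  have := pred_lt _ _ (ltnW q_gt1) qd_gt.
  by rewrite sE -{1}[q - 1]mul1n ltn_pmul2r // => /gtn_eqF ->.
have t1 : t != 1.
  have := pred_lt _ _ (ltn_trans (ltnW q_gt1) qd_gt) qdb_gt.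
  rewrite expnM tE -{1}[q ^ d - 1]mul1n ltn_pmul2r => [/gtn_eqF ->//|].
  by rewrite subn_gt0 (ltn_trans q_gt1).
have ptE : p = t * s.
  by apply/eqP; rewrite -(eqn_pmul2r q1_gt0) pE expnM tE sE mulnA.
have tp : t = p by apply/(prime_nt_dvdP p_prime); rewrite // ptE dvdn_mulr.
have /eqP := ptE; rewrite tp -{1}[p]muln1 eqn_pmul2l ?prime_gt0 //.
by rewrite eq_sym (negPf s1).
Qed.

Lemma Zmod_mulrn_pred n k (x : Zmod n) :
  0 < k -> n %| k - 1 -> (x *+ k = x)%R.
Proof.
move=> k_gt0 /dvdnP[c kE]; rewrite -(subnK k_gt0) addn1.
(* For [n = 0] the type [Zmod n] is ['I_1], hence trivial; otherwise the extra [k - 1] copies of [x]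
   form a multiple of [n]. *)
rewrite GRing.mulrS kE [(x *+ _)%R]Zp_mulrn; case: n x kE => [|n] x _.
  by rewrite ord1 (ord1 x).
by rewrite [inZp _](_ : _ = 0)%R ?addr0 //; apply: val_inj; rewrite /= mulnA modnMl.
Qed.

(** * Assembly of the cases *)

Theorem theorem13 (p n : nat) (H : {group {perm 'F_p}})
    (K : zmodClosed (code p n)) (phi : {perm 'F_p} -> qcode K)
    (p_prime : prime p)
    (H_cases : [\/ H :=: ('Alt_('F_p))%g, H :=: ('Sym_('F_p))%g
                 | translations p \subset H /\ H \subset AGL1 p])
    (n_gt0 : 0 < n)
    (n_cases : [\/ n = 2, n %| p - 1
                 | exists m r d : nat,
                     [/\ prime r, 0 < d,
                         p * (r ^ d - 1) = r ^ (d ^ m) - 1 & n %| m]])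
    (not_p2n2 : ~ (p = 2 /\ n = 2))
    (K_inv : invariant_code H K)
    (phi_crossed : crossed_hom (@qcode_act p n K) H phi) :
  exists psi : {perm 'F_p} -> qcode K,
    hom_into H (@qrepetition p n K) psi
    /\ cohomologous (@qcode_act p n K) H phi psi.
Proof.
have p_gt1 := prime_gt1 p_prime.
have n_dvd : n %| p - 1.
  have n2_dvd : n = 2 -> n %| p - 1.
    move=> n2; case: (even_prime p_prime) => [p2|p_odd]; first by case: not_p2n2.
    by rewrite n2 dvdn2 oddB ?p_odd // ltnW.
  case: n_cases => // -[m [r [d [r_prime d_gt0 pE n_m]]]].
  have n2 : n %| 2 by rewrite -(prime_repunit_exponent p_prime r_prime d_gt0 pE).
  have /primeP[_ /(_ n n2)/pred2P[->|/n2_dvd //]] : prime 2 by [].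
  exact: dvd1n.
have Zmod_p (x : Zmod n) : (x *+ p = x)%R by apply: Zmod_mulrn_pred; rewrite // ltnW.
(* For [p = 2], [n] divides 1, so the whole quotient code is trivial. *)
have [p2|p_neq2] := eqVneq p 2.
  have n1 : n = 1 by apply/eqP; rewrite -dvdn1 -[1]/(2 - 1) -p2.
  have Zmod0 : forall x : Zmod n, x = 0%R by rewrite n1 => x; apply: ord1.
  have qcode0 (x : qcode K) : x = 0%R.
    have [v ->] := qclassP x; apply/eqP; rewrite qclass_eq0.
    suff -> : v = 0%R by apply: rpred0.
    by apply/ffunP=> i; rewrite [LHS]Zmod0 [RHS]Zmod0.
  exists phi; split; last by exists 0%R => h _; rewrite [LHS]qcode0 [RHS]qcode0.
  split=> [x y _ _|h _]; first by rewrite [LHS]qcode0 [RHS]qcode0.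
  by rewrite (qcode0 (phi h)); apply: qrepetition0.
have p_odd : odd p by case: (even_prime p_prime) => // p2; rewrite p2 in p_neq2.
have transl_sub : translations p \subset H.
  case: H_cases => [-> | -> | [] //]; first exact: translations_sub_Alt.
  exact: subsetT.
have [a aE] := crossed_hom_coboundary_translations p_prime Zmod_p K_inv transl_sub phi_crossed.
pose psi h := (phi h - (qcode_act h^-1%g a - a))%R.
have psi_crossed := crossed_homB_coboundary K_inv phi_crossed a.
rewrite -/psi in psi_crossed.
have psi_transl b : psi (transl b) = 0%R by rewrite /psi aE subrr.
exists psi; split; last by exists a => h hH; rewrite /psi opprB addrC subrK.
have psi_qrep : {in H, forall h, qrepetition (psi h)}.
  apply: (crossed_hom_transl_conj p_prime Zmod_p K_inv transl_sub psi_crossed psi_transl).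
  (* A conjugate that is again a translation is immediate; this covers the affine case. Otherwise
     [H] contains the alternating group. *)
  move=> h b hH; have [/translationsP[c -> //]|not_transl] :=
    boolP ((transl b ^ h)%g \in translations p).
  have Alt_sub : ('Alt_('F_p))%g \subset H.
    case: H_cases => [-> | -> | [_ H_AGL]]; rewrite ?subsetT //.
    case/negP: not_transl.
    by rewrite AGL1_normalises_translations ?mem_transl ?(subsetP H_AGL).
  have conj_Alt : (transl b ^ h)%g \in ('Alt_('F_p))%g.
    by rewrite Alt_even odd_permJ transl_even.
  have p_ge5 : 5 <= p.
    rewrite ltn_neqAle; apply/andP; split; first by apply: contraTneq p_prime => <-.
    rewrite ltn_neqAle eq_sym ltn_neqAle [2 == p]eq_sym p_neq2 p_gt1 !andbT.
    by apply: contraNneq not_transl => p3; rewrite -(Alt3_translations p_prime p3).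
  have K_alt : invariant_code ('Alt_('F_p))%g K.
    by move=> g /(subsetP Alt_sub) gH; apply: K_inv.
  have psi_alt : crossed_hom (@qcode_act p n K) ('Alt_('F_p))%g psi.
    by move=> x y /(subsetP Alt_sub) xH /(subsetP Alt_sub) yH; apply: psi_crossed.
  have conj_qrep := alt_crossed_hom_qrepetition p_prime p_ge5 Zmod_p K_alt psi_alt
    psi_transl conj_Alt.
  (* The conjugate has a constant value and its [p]-th power is 1, so [p] times its value is 0; but
     multiplication by [p] is the identity. *)
  rewrite -[LHS](qcode_mulrn_p Zmod_p) -(crossed_homX K_inv psi_crossed) //.
    by rewrite -conjXg transl_order // conj1g (crossed_hom1 K_inv psi_crossed).
  exact: subsetP Alt_sub _ conj_Alt.
split=> [x y xH yH|]; last exact: psi_qrep.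
(* Constant classes are fixed by [H], so the cocycle law becomes additivity. *)
rewrite psi_crossed //.
by rewrite (qrepetition_act K_inv) ?groupV //; apply: psi_qrep.
Qed.
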